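(* Let $x_1,x_2,\ldots$ be iid $\mathrm{Bernoulli}(\theta)$ observations, and let the prior distribution of $\theta$ be the uniform distribution on $\Theta=(0,1)$. For every $\theta_0$ and $\theta_1$ in $\Theta$ the sequence $\psi_{\theta_0,\theta_1}(n)=\mathbb{E}_{\theta_1}[q_n^{\theta_0}]$ is log-concave for $n\geq1$ (and strictly log-concave for $n\geq2$), and hence unimodal.
   Context: For $s_n=(x_1,\ldots,x_n)\in\{0,1\}^n$ let $p_\theta(s_n)=\prod_{i=1}^n\theta^{x_i}(1-\theta)^{1-x_i}$ and $p(s_n)=\int_0^1 p_\theta(s_n)\,\mathrm{d}\theta$. The posterior density at $\theta_0$ (prior density $\equiv1$ on $(0,1)$) is $q_n^{\theta_0}(s_n)=p_{\theta_0}(s_n)/p(s_n)$, and $$\psi_{\theta_0,\theta_1}(n)=\mathbb{E}_{\theta_1}[q_n^{\theta_0}]=\sum_{s_n\in\{0,1\}^n}\frac{p_{\theta_0}(s_n)}{p(s_n)}\,p_{\theta_1}(s_n).$$ A sequence of positive numbers $\psi(n)$, $n\geq m$, is log-concave if $\psi(n)^2\geq\psi(n-1)\psi(n+1)$ for every $n\geq m+1$, and strictly log-concave if the inequality is strict for every $n\ge m+1$. Thus ''log-concave for $n\geq1$'' means the weak inequality for all $n\geq2$, and ''strictly log-concave for $n\ge2$'' means the strict inequality for all $n\geq3$. The sequence is unimodal if there exists $0\leq n_0\leq\infty$ such that $\psi(n)$ is (weakly) increasing for $n\leq n_0$ and (weakly) decreasing for $n\geq n_0$. *)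

(* Defs.v *)
From HB Require Import structures.
From mathcomp Require Import all_boot all_order all_algebra.
From mathcomp Require Import all_classical all_reals all_analysis.
Set Implicit Arguments.
Unset Strict Implicit.
Unset Printing Implicit Defensive.
Import Order.TTheory GRing.Theory Num.Theory.
Import numFieldNormedType.Exports.
Local Open Scope classical_set_scope.
Local Open Scope ring_scope.

Section BernoulliModel.
Variable R : realType.

(* Joint probability of a sample of n iid Bernoulli(theta) observations;
   an observation is a boolean, read as 0 or 1 in the exponents. *)
Definition likelihood (n : nat) (theta : R) (s : n.-tuple bool) : R :=
  \prod_(i < n) (theta ^+ (tnth s i) * (1 - theta) ^+ (1 - tnth s i)%N).

Definition marginal (n : nat) (s : n.-tuple bool) : R :=
  \int[lebesgue_measure]_(t in `[0, 1]) likelihood t s.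

(* The prior density is 1 on (0, 1), hence does not appear. *)
Definition posterior (n : nat) (theta0 : R) (s : n.-tuple bool) : R :=
  likelihood theta0 s / marginal s.

(* Expectation of a statistic of n iid Bernoulli(theta) observations. *)
Definition expect (n : nat) (theta : R) (f : n.-tuple bool -> R) : R :=
  \sum_(s : n.-tuple bool) f s * likelihood theta s.

Definition psi (theta0 theta1 : R) (n : nat) : R :=
  expect theta1 (@posterior n theta0).

End BernoulliModel.

Section Sequences.
Variable R : realType.

(* Properties of the sequence u(n), n >= m; the terms u(n) with n < m are
   irrelevant. *)

Definition log_concave (m : nat) (u : nat -> R) : Prop :=
  (forall n, (m <= n)%N -> 0 < u n) /\
  (forall n, (m.+1 <= n)%N -> u n.-1 * u n.+1 <= u n ^+ 2).

Definition strictly_log_concave (m : nat) (u : nat -> R) : Prop :=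
  (forall n, (m <= n)%N -> 0 < u n) /\
  (forall n, (m.+1 <= n)%N -> u n.-1 * u n.+1 < u n ^+ 2).

(* The mode ranges over the natural numbers extended by infinity, the latter
   being None. *)
Definition le_mode (n : nat) (n0 : option nat) : Prop :=
  if n0 is Some k then (n <= k)%N else True.

Definition ge_mode (n : nat) (n0 : option nat) : Prop :=
  if n0 is Some k then (k <= n)%N else False.

Definition unimodal (m : nat) (u : nat -> R) : Prop :=
  exists n0 : option nat,
    (forall i j, (m <= i <= j)%N -> le_mode j n0 -> u i <= u j) /\
    (forall i j, (m <= i <= j)%N -> ge_mode i n0 -> u j <= u i).

End Sequences.

(* Main.v *)
Require Import Defs.
From HB Require Import structures.
From mathcomp Require Import all_boot all_order all_algebra.
From mathcomp Require Import all_classical all_reals all_analysis.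
From mathcomp Require Import ring lra.
Import Order.TTheory GRing.Theory Num.Theory.
Local Open Scope ring_scope.
Set Implicit Arguments.
Unset Strict Implicit.
Unset Printing Implicit Defensive.

(** The marginal probability of a sample with k ones is the Beta integral
    k! (n - k)! / (n + 1)!, so that psi(n) = (n + 1) A(n) with

      A(n) = sum over k of C(n, k)^2 a^k b^(n - k),
      a = theta0 theta1,  b = (1 - theta0) (1 - theta1).

    For a <> b these are, up to a power of |a - b|, the values of the Legendre
    polynomials at (a + b) / |a - b|; they satisfy a three-term recurrence
    ([square_binomial_rec]).  Dividing A(n) by (a + b)^n does not affect
    log-concavity and leaves a single parameter w = 4 a b / (a + b)^2 in
    ]0, 1].  If the normalised ratio A(n) / ((a + b) A(n - 1)) is written
    1 + e(n), then e(1) = 0 and the recurrence becomes the first-order one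

      e(n + 1) = n (e(n) + w) / ((n + 1) (1 + e(n)))   ([excess_next]).

    In these terms psi(n)^2 - psi(n - 1) psi(n + 1) is, up to a positive
    factor, the quadratic form [turan] at e(n):

      T(n) = (n + 1)^3 e^2 + (n^2 + 4 n + 2) e + (n + 1) - n^2 (n + 2) w.

    For n = 2 this is 3 (1 - 3 w / 2)^2, which vanishes at w = 2/3; this is
    why strictness starts at n = 3 only.  It remains to see that T(n) >= 0
    implies T(n + 1) > 0 when n >= 2.  Two mechanisms share the work.

    - Where T(n) = 0, the next value T(n + 1) has the sign of
      (n + 1)^2 e(n) - (n - 1).  Hence as soon as e(n) exceeds the threshold
      (n - 1) / (n + 1)^2, the form cannot leave the positive half-line
      ([turan_step]).

    - The recurrence gives the elementary lower bound [excess_lb] for e(n).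
      It exceeds the threshold precisely when 3 (n + 1) (n + 2) w > 8, and
      in the opposite case w is so small that the bound for e(n + 1) alone
      makes T(n + 1) positive ([turan_excess_lb_gt0]). *)

(** * The Turan form and its evolution along the recurrence *)

(** For e = e(n) this is (n + 1) (psi(n)^2 - psi(n - 1) psi(n + 1)), if psi is
    scaled so that a + b = 1 and psi(n - 1) = n; see [turanE]. *)
Definition turan (R : realFieldType) (w n e : R) : R :=
  (n + 1) ^+ 3 * e ^+ 2 + (n ^+ 2 + 4 * n + 2) * e + (n + 1)
  - n ^+ 2 * (n + 2) * w.

(** The recurrence for e(n), so that the next ratio is 1 + excess_next. *)
Definition excess_next (R : realFieldType) (w n e : R) : R :=
  n * (e + w) / ((n + 1) * (1 + e)).

Lemma turanE (R : realFieldType) (w n e : R) : 0 <= n -> 0 <= e ->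
  turan w n e = (n + 1) * (1 + e) *
    ((n + 1) ^+ 2 * (1 + e) - n * (n + 2) * (1 + excess_next w n e)).
Proof.
move=> n0 e0; rewrite /turan /excess_next; field.
by rewrite !lt0r_neq0 //; lra.
Qed.

(** Eliminating w in favour of d, which is T(n) up to a positive factor, turns
    T(n + 1) into a quadratic polynomial in d.  Its constant term factors
    completely: this is the reason why the threshold on e is so simple. *)
Lemma turan_step_id (R : realFieldType) (w n e : R) : 0 < n -> 0 <= e ->
  let d := turan w n e / (n ^+ 2 * (n + 2)) in
  let g := (n + 1) ^+ 2 * e - (n - 1) in
  let z := (n + 1) * (n ^+ 2 + 4 * n + 5) * e
           - (n - 1) * (n ^+ 2 + 5 * n + 5) in
  (n + 1) ^+ 2 * (1 + e) ^+ 2 * turan w (n + 1) (excess_next w n e) =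
  (n + 1) ^+ 4 * (1 + e) ^+ 3 * g / (n ^+ 2 * (n + 2))
  - (n + 1) ^+ 2 * (1 + e) * z * d + n ^+ 2 * (n + 2) ^+ 3 * d ^+ 2.
Proof.
move=> n0 e0 d g z; rewrite /d /g /z /turan /excess_next.
field.
by rewrite !lt0r_neq0 //; lra.
Qed.

Lemma bernstein3_gt0 (R : realFieldType) (c0 c1 c2 c3 v w : R) :
  0 <= v -> 0 < w -> 0 <= c0 -> 0 <= c1 -> 0 <= c2 -> 0 < c3 ->
  0 < c0 * v ^+ 3 + c1 * w * v ^+ 2 + c2 * w ^+ 2 * v + c3 * w ^+ 3.
Proof.
move=> v0 w0 p0 p1 p2 p3; have w0' := ltW w0.
rewrite ltr_wpDl ?mulr_gt0 ?exprn_gt0 //.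
by rewrite !addr_ge0 // !mulr_ge0 // ?exprn_ge0.
Qed.

Lemma quad_gt0 (R : realFieldType) (a b c x : R) :
  0 < a -> b ^+ 2 < 4 * a * c -> 0 < a * x ^+ 2 - b * x + c.
Proof.
move=> a0 bc.
have : 0 < 4 * a * (a * x ^+ 2 - b * x + c).
  have -> : 4 * a * (a * x ^+ 2 - b * x + c)
    = (2 * a * x - b) ^+ 2 + (4 * a * c - b ^+ 2) by ring.
  by rewrite ltr_wpDl ?sqr_ge0 ?subr_gt0.
by rewrite pmulr_rgt0 // mulr_gt0.
Qed.

(** The constant term of the quadratic polynomial in d is positive by the
    threshold condition g > 0.  If z <= 0 all its terms are nonnegative.  If
    z > 0, then e is close to its largest possible value (n - 1) / n, which
    makes g large and z small, and the discriminant is negative. *)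
Lemma turan_step (R : realFieldType) (w n e : R) :
  2 <= n -> 0 <= e -> n * e <= n - 1 -> n - 1 < (n + 1) ^+ 2 * e ->
  0 <= turan w n e -> 0 < turan w (n + 1) (excess_next w n e).
Proof.
move=> n2 e0 en ge qe.
have n0 : 0 < n by lra.
have [n1 n20] : 0 < n + 1 /\ 0 < n + 2 by split; lra.
have e1 : 0 < 1 + e by lra.
suff : 0 < (n + 1) ^+ 2 * (1 + e) ^+ 2 * turan w (n + 1) (excess_next w n e).
  by rewrite pmulr_rgt0 // mulr_gt0 // exprn_gt0.
rewrite turan_step_id //.
set d := turan w n e / _; set g := _ - (n - 1); set z := _ - _ * (_ + 5).
have d0 : 0 <= d.
  by rewrite divr_ge0 // mulr_ge0 ?exprn_ge0 // ltW.
have g0 : 0 < g by rewrite subr_gt0.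
have p0 : 0 < n ^+ 2 * (n + 2) by rewrite mulr_gt0 ?exprn_gt0.
have c0 : 0 < (n + 1) ^+ 4 * (1 + e) ^+ 3 * g / (n ^+ 2 * (n + 2)).
  by rewrite divr_gt0 // !mulr_gt0 ?exprn_gt0.
have a0 : 0 < n ^+ 2 * (n + 2) ^+ 3 by rewrite mulr_gt0 ?exprn_gt0.
have [z0|z0] := leP z 0.
  have k0 : 0 <= - ((n + 1) ^+ 2 * (1 + e) * z * d).
    rewrite -mulNr -mulrN mulr_ge0 // mulr_ge0 ?oppr_ge0 //.
    by rewrite mulr_ge0 ?exprn_ge0 // ltW.
  have k1 : 0 <= n ^+ 2 * (n + 2) ^+ 3 * d ^+ 2.
    by rewrite mulr_ge0 ?sqr_ge0 // ltW.
  lra.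
have s0 : 0 < n ^+ 2 + 4 * n + 5.
  by rewrite !addr_gt0 ?exprn_gt0 ?mulr_gt0 //; lra.
have gn : n * (n - 1) <= g.
  have id : (n ^+ 2 + 4 * n + 5) * (g - n * (n - 1)) =
    (n + 1) * (z + n * (n - 1)) by rewrite /g /z; ring.
  have : 0 <= (n ^+ 2 + 4 * n + 5) * (g - n * (n - 1)).
    by rewrite id mulr_ge0 ?ltW // addr_gt0 // mulr_gt0; lra.
  by rewrite pmulr_rge0 // subr_ge0.
have zn : n * z <= (n - 1) * (4 * n + 5).
  have -> : n * z = (n + 1) * (n ^+ 2 + 4 * n + 5) * (n * e)
    - (n - 1) * (n ^+ 2 + 5 * n + 5) * n by rewrite /z; ring.
  have : 0 <= (n + 1) * (n ^+ 2 + 4 * n + 5) * (n - 1 - n * e).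
    by rewrite mulr_ge0 ?subr_ge0 // ltW // mulr_gt0.
  lra.
(* The discriminant condition, stripped of its common factors. *)
have disc : z ^+ 2 < 4 * (n + 2) ^+ 2 * g.
  have : n ^+ 2 * z ^+ 2 <= ((n - 1) * (4 * n + 5)) ^+ 2.
    rewrite -exprMn ler_pXn2r ?nnegrE //; first by rewrite mulr_ge0 // ltW.
    rewrite mulr_ge0; lra.
  have : ((n - 1) * (4 * n + 5)) ^+ 2
         < n ^+ 2 * (4 * (n + 2) ^+ 2 * (n * (n - 1))).
    rewrite -subr_gt0.
    have -> : n ^+ 2 * (4 * (n + 2) ^+ 2 * (n * (n - 1)))
      - ((n - 1) * (4 * n + 5)) ^+ 2 =
      (n - 1) * (4 * n ^+ 5 + 16 * n ^+ 2 * (n ^+ 2 - 2 ^+ 2)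
                 + 40 * n ^+ 2 + 15 * n + 25) by ring.
    have nn : 0 <= n ^+ 2 - 2 ^+ 2 by rewrite subr_ge0 ler_pXn2r ?nnegrE //; lra.
    have n52 : 0 <= n ^+ 5 /\ 0 <= n ^+ 2 by split; rewrite exprn_ge0 // ltW.
    rewrite mulr_gt0 //; first lra.
    have : 0 <= 16 * n ^+ 2 * (n ^+ 2 - 2 ^+ 2).
      by rewrite mulr_ge0 // mulr_ge0 //; lra.
    lra.
  have : n ^+ 2 * (4 * (n + 2) ^+ 2 * (n * (n - 1)))
         <= n ^+ 2 * (4 * (n + 2) ^+ 2 * g).
    rewrite ler_pM2l ?exprn_gt0 // ler_pM2l // mulr_gt0 ?exprn_gt0 //; lra.
  move=> h1 h2 h3.
  rewrite -(ltr_pM2l (exprn_gt0 2 n0)).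
  lra.
have := @quad_gt0 R (n ^+ 2 * (n + 2) ^+ 3) ((n + 1) ^+ 2 * (1 + e) * z)
  ((n + 1) ^+ 4 * (1 + e) ^+ 3 * g / (n ^+ 2 * (n + 2))) d a0.
suff -> : ((n + 1) ^+ 2 * (1 + e) * z) ^+ 2 <
  4 * (n ^+ 2 * (n + 2) ^+ 3) *
  ((n + 1) ^+ 4 * (1 + e) ^+ 3 * g / (n ^+ 2 * (n + 2))).
  by move=> /(_ isT); lra.
have -> : 4 * (n ^+ 2 * (n + 2) ^+ 3) *
  ((n + 1) ^+ 4 * (1 + e) ^+ 3 * g / (n ^+ 2 * (n + 2)))
  = ((n + 1) ^+ 4 * (1 + e) ^+ 2) * (4 * (n + 2) ^+ 2 * g * (1 + e)).
  by field; rewrite !lt0r_neq0.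
have -> : ((n + 1) ^+ 2 * (1 + e) * z) ^+ 2
  = ((n + 1) ^+ 4 * (1 + e) ^+ 2) * z ^+ 2 by ring.
rewrite ltr_pM2l; last by rewrite mulr_gt0 ?exprn_gt0.
apply: (lt_le_trans disc).
by rewrite ler_peMr ?lerDl // ltW // !mulr_gt0 ?exprn_gt0.
Qed.

(** * A lower bound for the excess *)

(** Expanding e(n) at w = 0 gives e(n) = (n - 1) w / 2 / (1 + c w + o(w)) with
    c = (n - 2) (n + 1) / 8; the bound drops the o(w). *)
Definition excess_lb (R : realFieldType) (w n : R) : R :=
  4 * (n - 1) * w / (8 + (n - 2) * (n + 1) * w).

(** [excess_next] is nondecreasing in e because w <= 1, so that it suffices
    to iterate the bound; the error of one iteration is of order w^3. *)
Lemma excess_next_lb (R : realFieldType) (w n e : R) :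
  0 <= w <= 1 -> 2 <= n -> excess_lb w n <= e ->
  excess_lb w (n + 1) <= excess_next w n e.
Proof.
move=> /andP[w0 w1] n2 le.
have d0 : 0 < 8 + (n - 2) * (n + 1) * w.
  by rewrite ltr_wpDr // !mulr_ge0 //; lra.
have d1 : 0 < 8 + (n - 1) * (n + 2) * w.
  by rewrite ltr_wpDr ?ltr0n // !mulr_ge0 //; lra.
have e0 : 0 <= excess_lb w n.
  by rewrite divr_ge0 ?(ltW d0) // !mulr_ge0 //; lra.
apply: (@le_trans _ _ (excess_next w n (excess_lb w n))); last first.
  rewrite /excess_next ler_pdivrMr ?mulr_gt0; try lra.
  rewrite mulrAC ler_pdivlMr ?mulr_gt0; try lra.
  have -> : n * (e + w) * ((n + 1) * (1 + excess_lb w n)) =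
    n * (excess_lb w n + w) * ((n + 1) * (1 + e))
    + n * (n + 1) * ((1 - w) * (e - excess_lb w n)) by ring.
  by rewrite lerDl !mulr_ge0; lra.
have d2 : 0 <= 4 * (n - 1) * w by rewrite !mulr_ge0 //; lra.
rewrite -subr_ge0.
have -> : excess_next w n (excess_lb w n) - excess_lb w (n + 1)
  = n * (w ^+ 3 * (n - 1) * (n + 1) * (n - 2) * (n + 2))
    / ((n + 1) * (8 + (n - 2) * (n + 1) * w + 4 * (n - 1) * w)
       * (8 + (n - 1) * (n + 2) * w)).
  rewrite /excess_next /excess_lb; field.
  by rewrite !lt0r_neq0 //; lra.
by rewrite divr_ge0 // !mulr_ge0 ?exprn_ge0 //; lra.
Qed.

(** For small w the constant term n + 2 of T(n + 1) dominates.  After clearing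
    the denominator of the bound, T(n + 1) is a cubic polynomial in w.  Written
    in the Bernstein basis of the interval where v = 8 - 3 (n + 1) (n + 2) w
    is nonnegative, that is in the products w^j v^(3 - j), it has coefficients
    that are polynomials in x = n - 2 with positive coefficients only. *)
Lemma turan_excess_lb_gt0 (R : realFieldType) (w n : R) :
  0 < w -> 2 <= n -> 3 * (n + 1) * (n + 2) * w <= 8 ->
  0 < turan w (n + 1) (excess_lb w (n + 1)).
Proof.
move=> w0 n2 w8.
have d0 : 0 < 8 + (n - 1) * (n + 2) * w.
  by rewrite ltr_wpDr ?ltr0n // !mulr_ge0 ?(ltW w0) //; lra.
have [x [nE x0]] : exists x, n = x + 2 /\ 0 <= x.
  by exists (n - 2); split; lra.
pose v := 8 - 3 * (n + 1) * (n + 2) * w.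
have v0 : 0 <= v by rewrite subr_ge0.
suff : 0 < (8 + (n - 1) * (n + 2) * w) ^+ 2
           * turan w (n + 1) (excess_lb w (n + 1)).
  by rewrite pmulr_rgt0 // exprn_gt0.
have -> : (8 + (n - 1) * (n + 2) * w) ^+ 2
           * turan w (n + 1) (excess_lb w (n + 1)) =
  (n + 2) / 8 * v ^+ 3
  + (36 + 67 / 2 * x + 77 / 8 * x ^+ 2 + 7 / 8 * x ^+ 3) * w * v ^+ 2
  + (900 + 1527 * x + 1959 / 2 * x ^+ 2 + 599 / 2 * x ^+ 3 + 44 * x ^+ 4
     + 5 / 2 * x ^+ 5) * w ^+ 2 * v
  + (20256 * x + 19882 * x ^+ 2 + 10353 * x ^+ 3 + 6223 / 2 * x ^+ 4
     + 1085 / 2 * x ^+ 5 + 51 * x ^+ 6 + 2 * x ^+ 7 + 8352) * w ^+ 3.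
  rewrite /turan /excess_lb /v nE; field.
  by rewrite lt0r_neq0 //; move: d0; rewrite nE; lra.
have x2 : 0 <= x ^+ 2 by rewrite exprn_ge0.
have x3 : 0 <= x ^+ 3 by rewrite exprn_ge0.
have x4 : 0 <= x ^+ 4 by rewrite exprn_ge0.
have x5 : 0 <= x ^+ 5 by rewrite exprn_ge0.
have x6 : 0 <= x ^+ 6 by rewrite exprn_ge0.
have x7 : 0 <= x ^+ 7 by rewrite exprn_ge0.
by apply: (bernstein3_gt0 v0 w0); lra.
Qed.

(** * Positivity of the Turan form *)

(** The index is shifted: [excess w m] is e(m + 1), so that it starts at
    e(1) = 0. *)
Fixpoint excess (R : realFieldType) (w : R) (m : nat) : R :=
  if m is k.+1 then excess_next w k.+1%:R (excess w k) else 0.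

Section Excess.
Variables (R : realFieldType) (w : R).
Hypothesis w01 : 0 < w <= 1.

Lemma excess_ge0 m : 0 <= excess w m.
Proof.
have /andP[w0 _] := w01.
elim: m => [|m IH] //=; rewrite /excess_next.
by rewrite divr_ge0 // mulr_ge0 ?addr_ge0 ?ler0n ?(ltW w0).
Qed.

Lemma excess_ub m : m.+1%:R * excess w m <= m%:R.
Proof.
have /andP[w0 w1] := w01.
case: m => [|m] /=; first by rewrite mulr0.
have e0 := excess_ge0 m.
have m0 : 0 < m.+1%:R :> R by rewrite ltr0n.
rewrite /excess_next -(natr1 m.+1).
have -> : (m.+1%:R + 1) * (m.+1%:R * (excess w m + w) /
    ((m.+1%:R + 1) * (1 + excess w m)))
  = m.+1%:R * ((excess w m + w) / (1 + excess w m)) :> R.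
  by field; rewrite !lt0r_neq0 //; lra.
by rewrite ler_piMr ?(ltW m0) // ler_pdivrMr; lra.
Qed.

Lemma excess_lbP m : excess_lb w m.+2%:R <= excess w m.+1.
Proof.
have /andP[w0 w1] := w01.
elim: m => [|m IH].
  rewrite /= /excess_lb /excess_next le_eqVlt; apply/orP; left; apply/eqP.
  by field.
rewrite -natr1; apply: excess_next_lb => //; first by rewrite ltW.
by rewrite (ler_nat _ 2).
Qed.

(** This strict inequality is equivalent to the condition on w, which is
    therefore the exact complement of the range of [turan_excess_lb_gt0]. *)
Lemma excess_lb_threshold (n : R) :
  2 <= n -> 8 < 3 * (n + 1) * (n + 2) * w ->
  n - 1 < (n + 1) ^+ 2 * excess_lb w n.
Proof.
have /andP[w0 w1] := w01.
move=> n2 w8; have d0 : 0 < 8 + (n - 2) * (n + 1) * w.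
  by rewrite ltr_wpDr // !mulr_ge0 ?(ltW w0) //; lra.
rewrite /excess_lb mulrA ltr_pdivlMr // -subr_gt0.
have -> : (n + 1) ^+ 2 * (4 * (n - 1) * w)
  - (n - 1) * (8 + (n - 2) * (n + 1) * w)
  = (n - 1) * (3 * (n + 1) * (n + 2) * w - 8) by ring.
by rewrite mulr_gt0 //; lra.
Qed.

Lemma ler_turan (n e f : R) : 0 <= n -> 0 <= e -> e <= f ->
  turan w n e <= turan w n f.
Proof.
move=> n0 e0 ef.
have p0 : 0 <= n ^+ 2 by rewrite sqr_ge0.
rewrite /turan lerD2r lerD2r lerD // ler_wpM2l //.
- by rewrite exprn_ge0 //; lra.
- by rewrite ler_pXn2r ?nnegrE // (le_trans e0).
- lra.
Qed.

Lemma turan_excess1_ge0 : 0 <= turan w 2 (excess w 1).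
Proof.
have -> : turan w 2 (excess w 1) = 3 * (1 - 3 / 2 * w) ^+ 2.
  by rewrite /turan /= /excess_next; field.
by rewrite mulr_ge0 ?sqr_ge0.
Qed.

(** Induction on n: for small w the lower bound for e(n + 1) suffices, and
    otherwise the lower bound for e(n) puts [turan_step] into action. *)
Lemma turan_excess_gt0 m : 0 < turan w m.+3%:R (excess w m.+2).
Proof.
have /andP[w0 w1] := w01.
have step k : 0 <= turan w k.+2%:R (excess w k.+1) ->
  0 < turan w k.+3%:R (excess w k.+2).
  have n2 : 2 <= k.+2%:R :> R by rewrite (ler_nat _ 2).
  move=> q0; have [w8|w8] := lerP (3 * (k.+2%:R + 1) * (k.+2%:R + 2) * w) 8.
    apply: (@lt_le_trans _ _ (turan w k.+3%:R (excess_lb w k.+3%:R))).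
      by rewrite -(natr1 k.+2); apply: turan_excess_lb_gt0.
    apply: ler_turan; rewrite ?ler0n //; last exact: excess_lbP.
    rewrite /excess_lb -natr1 divr_ge0 //.
      by rewrite !mulr_ge0 ?(ltW w0) //; lra.
    by rewrite addr_ge0 // !mulr_ge0 ?(ltW w0) //; lra.
  rewrite -(natr1 k.+2); apply: (@turan_step _ w _ (excess w k.+1)) => //.
  - exact: excess_ge0.
  - by rewrite -[k.+2%:R in X in _ <= X]natr1 addrK excess_ub.
  - apply: (lt_le_trans (excess_lb_threshold n2 w8)).
    by rewrite ler_wpM2l ?sqr_ge0 ?excess_lbP.
elim: m => [|m IH]; apply: step; last exact: ltW.
exact: turan_excess1_ge0.
Qed.

Lemma turan_excess_ge0 m : 0 <= turan w m.+2%:R (excess w m.+1).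
Proof.
case: m => [|m]; first exact: turan_excess1_ge0.
exact/ltW/turan_excess_gt0.
Qed.
End Excess.

(** * Log-concave sequences are unimodal *)

(** Once the sequence decreases it decreases for ever, since the ratios of
    consecutive terms are nonincreasing; the mode is the first descent. *)
Lemma log_concave_unimodal (R : realType) (u : nat -> R) :
  log_concave 1 u -> unimodal 1 u.
Proof.
move=> [u_gt0 u_lc].
have dec k j : (0 < k)%N -> u k.+1 <= u k -> (k <= j)%N -> u j.+1 <= u j.
  move=> k0 dk; elim: j => [|j IH].
    by rewrite leqn0 => /eqP k_eq0; rewrite k_eq0 in k0.
  rewrite leq_eqVlt ltnS => /orP[/eqP <- //|kj].
  have j0 : (0 < j)%N := leq_trans k0 kj.
  have := u_lc j.+1 j0; rewrite /= expr2 => lc.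
  rewrite -(ler_pM2l (u_gt0 _ j0)) (le_trans lc) // ler_pM2r ?u_gt0 //.
  exact: IH.
have [[k [k0 dk]]|noex] := pselect (exists k, (0 < k)%N /\ u k.+1 <= u k).
  pose P k := (0 < k)%N && (u k.+1 <= u k).
  have exP : exists k, P k by exists k; rewrite /P k0 dk.
  case: (ex_minnP exP) => n0 /andP[n0_gt0 dn0] min_n0.
  exists (Some n0); split=> i j /andP[i0] /=.
    move=> ij jn0; elim: j ij jn0 => [|j IH].
      by rewrite leqn0 => /eqP ->.
    rewrite leq_eqVlt ltnS => /orP[/eqP -> //|ij] jn0.
    apply: (le_trans (IH ij (ltnW jn0))).
    rewrite leNgt; apply/negP => /ltW dj.
    have := min_n0 j; rewrite /P (leq_trans i0 ij) dj => /(_ isT).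
    by rewrite leqNgt jn0.
  move=> ij n0i; elim: j ij => [|j IH].
    by rewrite leqn0 => /eqP ->.
  rewrite leq_eqVlt ltnS => /orP[/eqP -> //|ij].
  by rewrite (le_trans _ (IH ij)) // (dec n0) // (leq_trans n0i).
exists None; split=> i j /andP[i0] //= ij _; elim: j ij => [|j IH].
  by rewrite leqn0 => /eqP ->.
rewrite leq_eqVlt ltnS => /orP[/eqP -> //|ij].
apply: (le_trans (IH ij)); rewrite leNgt; apply/negP => /ltW dj.
by apply: noex; exists j; split => //; exact: leq_trans ij.
Qed.

(** * The expected posterior density as a sum of squared binomials *)

Lemma likelihoodE (R : realType) n (theta : R) (s : n.-tuple bool) :
  let k := (\sum_(i < n) tnth s i)%N in
  likelihood theta s = theta ^+ k * (1 - theta) ^+ (n - k).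
Proof.
move=> k; rewrite /likelihood big_split /= -!expr_sum; congr (_ * _ ^+ _).
rewrite sumnB ?sum1_card ?card_ord // => i _.
by case: (tnth s i).
Qed.

(** Inverting the Beta integral k! (n - k)! / (n + 1)! turns it into a binomial
    coefficient, which is the source of the squares in [psiE]. *)
Lemma marginalE (R : realType) n (s : n.-tuple bool) :
  let k := (\sum_(i < n) tnth s i)%N in
  (marginal R s)^-1 = n.+1%:R * 'C(n, k)%:R.
Proof.
move=> k.
have kn : (k <= n)%N.
  rewrite -[leqRHS]card_ord -sum1_card; apply: leq_sum => i _.
  by case: (tnth s i).
have -> : marginal R s = beta_fun k.+1 (n - k).+1.
  rewrite /marginal /beta_fun -Rintegral_mkcond.
  by apply: eq_Rintegral => t _; rewrite likelihoodE.
rewrite beta_fun_fact subnKC // invf_div factS -(bin_fact kn).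
rewrite !natrM; field.
by rewrite !pnatr_eq0 -!lt0n !fact_gt0.
Qed.

(** A boolean tuple is the indicator of a subset, and there are C(n, k)
    subsets with k elements. *)
Lemma sum_tuple_weight (R : realType) n (F : nat -> R) :
  \sum_(s : n.-tuple bool) F (\sum_(i < n) tnth s i)%N =
  \sum_(k < n.+1) 'C(n, k)%:R * F k.
Proof.
rewrite (reindex (fun A : {set 'I_n} => [tuple i \in A | i < n])) /=; last first.
  exists (fun s : n.-tuple bool => [set i | tnth s i]%SET) => [A _|s _].
    by apply/setP => i; rewrite inE tnth_mktuple.
  by apply: eq_from_tnth => i; rewrite tnth_mktuple inE.
under eq_bigr => A _.
  under eq_bigr do rewrite tnth_mktuple.
  rewrite -big_mkcond /= sum1_card. over.
rewrite /= (partition_big (fun A : {set 'I_n} => inord #|A| : 'I_n.+1) xpredT) //=.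
have cardA (A : {set 'I_n}) : (#|A| < n.+1)%N.
  by rewrite ltnS -[leqRHS]card_ord max_card.
apply: eq_bigr => k _.
have -> : 'C(n, k)%:R = \sum_(A : {set 'I_n} | #|A| == k) 1 :> R.
  transitivity (\sum_(A in [set A : {set 'I_n} | #|A| == k]%SET) 1 : R).
    by rewrite sumr_const card_draws card_ord.
  by apply: eq_bigl => A; rewrite inE.
rewrite mulr_suml.
apply: eq_big => A; first by rewrite -val_eqE /= inordK.
by move=> /eqP <-; rewrite inordK // mul1r.
Qed.

(** * The three-term recurrence *)

(** (1 - X)^n times the Legendre polynomial of degree n at
    (1 + X) / (1 - X). *)
Definition square_binomial (R : realType) (n : nat) : {poly R} :=
  \poly_(k < n.+1) ('C(n, k) ^ 2)%:R.

Section SquareBinomial.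
Variable R : realType.
Local Notation P := (@square_binomial R).

Lemma coef_square_binomial n k : (P n)`_k = 'C(n, k)%:R ^+ 2.
Proof.
rewrite coef_poly; case: ltnP => [_|kn]; first by rewrite natrX.
by rewrite bin_small // expr0n.
Qed.

(** Bonnet's recurrence for Legendre polynomials.  Comparing coefficients and
    applying Pascal's rule, it amounts to a quadratic relation between three
    consecutive binomials p, q, r of the same row (h3 below), which follows
    from the two relations between neighbours h1 and h2. *)
Lemma square_binomial_rec n :
  n.+2%:R *: P n.+2 = (2 * n + 3)%:R *: ((1 + 'X) * P n.+1)
                      - n.+1%:R *: ((1 - 'X) ^+ 2 * P n).
Proof.
have -> : (1 - 'X) ^+ 2 * P n = P n - 'X * P n *+ 2 + 'X * ('X * P n) by ring.
rewrite mulrDl mul1r.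
apply/polyP => -[|[|k]];
  rewrite !(coefB, coefD, coefZ, coefMn, coefXM) /= !coef_square_binomial.
- by rewrite !bin0; ring.
- by rewrite !bin1 !bin0; ring.
rewrite !binS.
have h1 : k.+1%:R * 'C(n, k.+1)%:R = (n%:R - k%:R) * 'C(n, k)%:R :> R.
  have [kn|nk] := leqP k n; first by rewrite -natrM mul_bin_left natrM natrB.
  by rewrite !bin_small ?mulr0 // ltnW.
have h2 : k.+2%:R * 'C(n, k.+2)%:R = (n%:R - k.+1%:R) * 'C(n, k.+1)%:R :> R.
  have [kn|nk] := leqP k.+1 n; first by rewrite -natrM mul_bin_left natrM natrB.
  by rewrite !bin_small ?mulr0 // ltnW.
rewrite !natrD.
move: ('C(n, k)%:R) ('C(n, k.+1)%:R) ('C(n, k.+2)%:R) h1 h2 => p q r h1 h2.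
have h3 : n%:R * q ^+ 2 = p * q + q * r + (n%:R + 2) * p * r.
  have k2 : k.+2%:R != 0 :> R by rewrite pnatr_eq0.
  apply: (mulfI k2).
  have -> : k.+2%:R * (p * q + q * r + (n%:R + 2) * p * r)
    = q * (k.+2%:R * p) + (q + (n%:R + 2) * p) * (k.+2%:R * r) by ring.
  rewrite h2.
  have -> : q * (k.+2%:R * p) + (q + (n%:R + 2) * p) * ((n%:R - k.+1%:R) * q)
    = (n%:R + 1) * q * ((n%:R - k%:R) * p) + (n%:R - k.+1%:R) * q ^+ 2 :> R.
    ring.
  by rewrite -h1; ring.
lra.
Qed.

Lemma horner_square_binomial_gt0 n (z : R) : 0 < z -> 0 < (P n).[z].
Proof.
move=> z0; rewrite horner_poly big_ord_recl /= bin0 expr0 mulr1.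
rewrite ltr_pwDl // sumr_ge0 // => k _.
by rewrite mulr_ge0 ?exprn_ge0 // ltW.
Qed.

Lemma parameter_bounds (z : R) : 0 < z -> 0 < 4 * z / (1 + z) ^+ 2 <= 1.
Proof.
move=> z0; have s0 : 0 < (1 + z) ^+ 2 by rewrite exprn_gt0 // addr_gt0.
apply/andP; split; first by rewrite divr_gt0 // mulr_gt0.
rewrite ler_pdivrMr // mul1r -subr_ge0.
have -> : (1 + z) ^+ 2 - 4 * z = (1 - z) ^+ 2 by ring.
exact: sqr_ge0.
Qed.

(** Here w = 4 z / (1 + z)^2, that is ((1 - z) / (1 + z))^2 = 1 - w, so
    that the three-term recurrence divided by (1 + z) and by the previous value
    becomes [excess_next]. *)
Lemma horner_square_binomialS n (z : R) : 0 < z ->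
  (P n.+1).[z] = (1 + z) * (1 + excess (4 * z / (1 + z) ^+ 2) n) * (P n).[z].
Proof.
move=> z0; set w := 4 * z / _; set e := excess w.
have w01 : 0 < w <= 1 := parameter_bounds z0.
elim: n => [|n IH].
  rewrite !horner_poly !big_ord_recl big_ord0 /=.
  rewrite big_ord0 !bin0 binn !exp1n expr0 expr1 -[e 0]/(0 : R); ring.
have e1 : 0 < 1 + e n by rewrite ltr_wpDr // excess_ge0.
have n2 : n.+2%:R != 0 :> R by rewrite pnatr_eq0.
have Pn : (P n).[z] = (P n.+1).[z] / ((1 + z) * (1 + e n)).
  by rewrite IH mulrC mulKf // mulf_neq0 // lt0r_neq0 // addr_gt0.
have rec : n.+2%:R * (P n.+2).[z] = (2 * n + 3)%:R * ((1 + z) * (P n.+1).[z])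
    - n.+1%:R * ((1 - z) ^+ 2 * (P n).[z]).
  by rewrite -hornerZ square_binomial_rec !hornerE.
have -> : e n.+1 = n.+1%:R * (e n + w) / ((n.+1%:R + 1) * (1 + e n)) by [].
apply: (mulfI n2); rewrite rec Pn /w natrD natrM; field.
have n0 : 0 <= n%:R :> R by rewrite ler0n.
by rewrite !lt0r_neq0 //; lra.
Qed.
End SquareBinomial.

(** * The theorem *)

Lemma psiE (R : realType) (theta0 theta1 : R) n :
  psi theta0 theta1 n = n.+1%:R * \sum_(k < n.+1)
    'C(n, k)%:R ^+ 2 * (theta0 * theta1) ^+ k
      * ((1 - theta0) * (1 - theta1)) ^+ (n - k).
Proof.
pose F k := n.+1%:R * ('C(n, k)%:R * (theta0 * theta1) ^+ k
      * ((1 - theta0) * (1 - theta1)) ^+ (n - k)).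
transitivity (\sum_(s : n.-tuple bool) F (\sum_(i < n) tnth s i)%N).
  apply: eq_bigr => s _; rewrite /posterior !likelihoodE marginalE.
  by rewrite /F !exprMn; ring.
rewrite sum_tuple_weight mulr_sumr; apply: eq_bigr => k _.
by rewrite /F; ring.
Qed.

Lemma psi_square_binomial (R : realType) (theta0 theta1 : R) n :
  theta0 != 1 -> theta1 != 1 ->
  let b := (1 - theta0) * (1 - theta1) in
  psi theta0 theta1 n =
  n.+1%:R * b ^+ n * (square_binomial R n).[theta0 * theta1 / b].
Proof.
move=> h0 h1 b; have b0 : b != 0 by rewrite mulf_neq0 // subr_eq0 eq_sym.
rewrite psiE -mulrA horner_poly; congr (_ * _); rewrite mulr_sumr.
apply: eq_bigr => k _; rewrite natrX expr_div_n -/b.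
have -> : b ^+ n = b ^+ (n - k) * b ^+ k by rewrite -exprD subnK // -ltnS.
by field; rewrite expf_neq0.
Qed.

Theorem theorem2 (R : realType) (theta0 theta1 : R)
    (htheta0 : 0 < theta0 < 1) (htheta1 : 0 < theta1 < 1) :
  [/\ log_concave 1 (psi theta0 theta1),
      strictly_log_concave 2 (psi theta0 theta1) &
      unimodal 1 (psi theta0 theta1)].
Proof.
have /andP[a0 a1] := htheta0; have /andP[b0 b1] := htheta1.
pose b := (1 - theta0) * (1 - theta1); pose z := theta0 * theta1 / b.
have b_gt0 : 0 < b by rewrite mulr_gt0 // subr_gt0.
have z_gt0 : 0 < z by rewrite divr_gt0 // mulr_gt0.
pose P n := (square_binomial R n).[z].
have P_gt0 n : 0 < P n := horner_square_binomial_gt0 n z_gt0.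
have psi_P n : psi theta0 theta1 n = n.+1%:R * b ^+ n * P n.
  by rewrite psi_square_binomial // lt_eqF.
have psi_gt0 n : 0 < psi theta0 theta1 n.
  by rewrite psi_P mulr_gt0 // mulr_gt0 ?exprn_gt0.
pose w := 4 * z / (1 + z) ^+ 2.
have w01 : 0 < w <= 1 := parameter_bounds z_gt0.
have turan_psi m :
  m.+3%:R * (psi theta0 theta1 m.+2 ^+ 2
             - psi theta0 theta1 m.+1 * psi theta0 theta1 m.+3) =
  (b ^+ m.+2 * (1 + z) * P m.+1) ^+ 2 * turan w m.+2%:R (excess w m.+1).
  have e0 := excess_ge0 w01 m.+1.
  have PS k : P k.+1 = (1 + z) * (1 + excess w k) * P k.
    exact: horner_square_binomialS.
  rewrite !psi_P !PS turanE // [excess w m.+2]/= -/(excess w m.+1).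
  rewrite !exprS -(natr1 m.+3) -(natr1 m.+2); ring.
have scale_gt0 m : 0 < (b ^+ m.+2 * (1 + z) * P m.+1) ^+ 2.
  have bm : 0 < b ^+ m.+2 := exprn_gt0 _ b_gt0.
  by rewrite exprn_gt0 // mulr_gt0 // mulr_gt0 // addr_gt0.
have lc : log_concave 1 (psi theta0 theta1).
  split=> [n _|[|[|m]] // _]; first exact: psi_gt0.
  rewrite -subr_ge0 -(pmulr_rge0 _ (ltr0Sn R m.+2)) turan_psi.
  exact: mulr_ge0 (ltW (scale_gt0 m)) (turan_excess_ge0 w01 m).
split=> //; last exact: log_concave_unimodal.
split=> [n _|[|[|[|m]]] // _]; first exact: psi_gt0.
rewrite -subr_gt0 -(pmulr_rgt0 _ (ltr0Sn R m.+3)) turan_psi.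
exact: mulr_gt0 (scale_gt0 m.+1) (turan_excess_gt0 w01 m).
Qed.
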